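(* Let $N\ge 1$ and $K\ge N$ be integers, let $0<p<1$, and let $k\in\mathbb{N}$. Let $\rho_{N,K,p}$ be the one-point function of the Krawtchouk ensemble. Then the factorial moment $$M_{K,p}(k,N)=\int x(x-1)\cdots(x-k+1)\,\mathrm{d}\rho_{N,K,p}(x)=\sum_{x=0}^{K}x(x-1)\cdots(x-k+1)\,\rho_{N,K,p}(x)$$ is given by $$M_{K,p}(k,N)=\sum_{i=0}^{k}p^{k-i}(1-p)^{i}\binom{k}{i}^{2}\frac{1}{N}\sum_{l=i}^{N-1}\frac{l!\,(K-l)!}{(l-i)!\,(K-l-k+i)!}.$$
   Context: Conventions: $\mathbb{N}=\{0,1,2,\dots\}$; an empty product is $1$ and an empty sum is $0$; $1/n!=0$ for negative integers $n$. Hypergeometric notation: $(a)_i=a(a+1)\cdots(a+i-1)$, and ${}_2F_1\left(\begin{matrix}a,b\\ c\end{matrix};z\right)=\sum_{i\ge 0}\frac{(a)_i(b)_i}{(c)_i}\frac{z^i}{i!}$, where the series stops at the first vanishing numerator factor when $a$ or $b$ is a nonpositive integer. The binomial reference measure is $\mu_{K,p}(x)=\binom{K}{x}p^x(1-p)^{K-x}$, $x=0,1,\dots,K$. The normalised Krawtchouk polynomials (orthonormal with respect to $\mu_{K,p}$) are, for $n=0,1,\dots,K$, $$k_n(x;p,K)=\sqrt{\binom{K}{n}\left(\frac{p}{1-p}\right)^n}\;{}_2F_1\left(\begin{matrix}-n,-x\\ -K\end{matrix};\frac1p\right).$$ The one-point function of the Krawtchouk ensemble with $N$ particles is the probability mass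 function on $\{0,\dots,K\}$ $$\rho_{N,K,p}(x)=\frac1N\sum_{n=0}^{N-1}k_n(x;p,K)^2\,\mu_{K,p}(x).$$ *)

(* Defs.v *)
From HB Require Import structures.
From mathcomp Require Import all_boot all_order all_algebra.
From mathcomp Require Import reals topology normedtype sequences.

Set Implicit Arguments.
Unset Strict Implicit.
Unset Printing Implicit Defensive.

Import Order.TTheory GRing.Theory Num.Theory.
Import numFieldNormedType.Exports.

Local Open Scope ring_scope.

Section Krawtchouk.
Context {R : realType}.

Definition pochhammer (a : R) (i : nat) : R := \prod_(j < i) (a + j%:R).

(* When [a] or [b] is a nonpositive integer, the numerator is zero from some
   index on; since [0 / 0 = 0], all later terms vanish, even where
   [pochhammer c i = 0], so the series stops there as required. *)
Definition hyp2F1 (a b c z : R) : R :=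
  limn [series pochhammer a i * pochhammer b i / pochhammer c i
               * (z ^+ i / i`!%:R)]_i.

Definition binomial_weight (K : nat) (p : R) (x : nat) : R :=
  'C(K, x)%:R * p ^+ x * (1 - p) ^+ (K - x).

Definition krawtchouk (K : nat) (p : R) (n x : nat) : R :=
  Num.sqrt ('C(K, n)%:R * (p / (1 - p)) ^+ n)
  * hyp2F1 (- n%:R) (- x%:R) (- K%:R) p^-1.

Definition one_point (N K : nat) (p : R) (x : nat) : R :=
  N%:R^-1 * \sum_(0 <= n < N) krawtchouk K p n x ^+ 2 * binomial_weight K p x.

Definition factorial_moment (K : nat) (p : R) (k N : nat) : R :=
  \sum_(0 <= x < K.+1) (x ^_ k)%:R * one_point N K p x.

(* [1 / z!], with the convention that it is zero for negative [z]. *)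
Definition inv_fact (z : int) : R :=
  if z is Posz n then n`!%:R^-1 else 0.

End Krawtchouk.

(* Main.v *)
(* Up to scalars, k_n(x; p, K) is the coefficient of t^n in
   (1 + t)^(K-x) (1 - (q/p) t)^x, where q = 1 - p.  Multiplying the generating
   functions in s and t and summing against x(x-1)...(x-k+1) mu_{K,p}(x) with
   the binomial theorem gives
     K(K-1)...(K-k+1) p^k (1 - (q/p) s)^k (1 - (q/p) t)^k (1 + (q/p) s t)^(K-k),
   and the moment of k_n^2 is read off from the coefficient of s^n t^n. *)
Require Import Defs.
From HB Require Import structures.
From mathcomp Require Import all_boot all_order all_algebra.
From mathcomp Require Import reals.
From mathcomp Require Import topology normedtype sequences.
From mathcomp Require Import ring zify.

Set Implicit Arguments.
Unset Strict Implicit.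
Unset Printing Implicit Defensive.

Import Order.TTheory GRing.Theory Num.Theory.
Import numFieldNormedType.Exports.

Local Open Scope ring_scope.

(** * The hypergeometric series as a finite sum *)

Lemma pochhammer_oppn (R : realType) (n i : nat) :
  pochhammer (- n%:R : R) i = (-1) ^+ i * (n ^_ i)%:R.
Proof.
rewrite /pochhammer; elim: i => [|i IHi]; first by rewrite big_ord0 mulr1.
rewrite big_ord_recr /= {}IHi ffactnSr exprS natrM.
have [le_in|lt_ni] := leqP i n; first by rewrite natrB //; ring.
by rewrite ffact_small // !(mulr0, mul0r).
Qed.

Lemma sum_nat_zero_tail (V : nmodType) (u : nat -> V) (n m : nat) :
  (n <= m)%N -> (forall i, (n <= i)%N -> u i = 0) ->
  \sum_(0 <= i < m) u i = \sum_(0 <= i < n) u i.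
Proof.
move=> le_nm u0; rewrite (@big_cat_nat _ _ _ n) //=.
rewrite [X in _ + X]big_nat_cond [X in _ + X]big1 ?addr0 //.
by move=> i /andP[/andP[/u0]].
Qed.

Lemma limn_series_finite (R : realType) (u : nat -> R) (n : nat) :
  (forall i, (n <= i)%N -> u i = 0) ->
  limn (series u) = \sum_(0 <= i < n) u i.
Proof.
move=> u0; apply/cvg_lim => //.
apply: cvg_near_cst; exists n => // m /= le_nm.
by rewrite /series /= (sum_nat_zero_tail le_nm).
Qed.

(** The three Pochhammer symbols each carry a sign [(-1) ^+ i]; two of them cancel and the third
    goes into [(- z) ^+ i]. The falling factorial of [x] over [i!] is a binomial coefficient, and
    that of [n] ends the series. *)
Lemma hyp2F1_krawtchouk (R : realType) (K n x : nat) (z : R) :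
  hyp2F1 (- n%:R) (- x%:R) (- K%:R) z =
  \sum_(0 <= i < n.+1) (n ^_ i)%:R / (K ^_ i)%:R * 'C(x, i)%:R * (- z) ^+ i.
Proof.
rewrite /hyp2F1 (@limn_series_finite _ _ n.+1); last first.
  by move=> i lt_ni /=; rewrite pochhammer_oppn ffact_small // mulr0 !mul0r.
apply: eq_bigr => i _ /=; rewrite !pochhammer_oppn -(bin_ffact x) natrM.
have fact_neq0 : i`!%:R != 0 :> R by rewrite pnatr_eq0 -lt0n fact_gt0.
rewrite [(- z) ^+ i]exprNn [((-1) ^+ i * (K ^_ i)%:R)^-1]invfM -exprVn invrN1.
set s := (-1) ^+ i; have ss : s * s = 1 by rewrite -expr2 sqrr_sign.
transitivity ((n ^_ i)%:R / (K ^_ i)%:R * 'C(x, i)%:R * (s * z ^+ i)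
  * (s * s) * (i`!%:R / i`!%:R)); first ring.
by rewrite ss divff // !mulr1.
Qed.

(** * Generating function of the Krawtchouk polynomials *)

(** Multiplied by [(n - i)! (K - n)!], both sides become [K!]. *)
Lemma mul_bin_ffact (K n i : nat) : (i <= n <= K)%N ->
  ('C(K, n) * n ^_ i = 'C(K - i, n - i) * K ^_ i)%N.
Proof.
move=> /andP[le_in le_nK]; have le_iK := leq_trans le_in le_nK.
apply/eqP; rewrite -(eqn_pmul2r (fact_gt0 (n - i))) -(eqn_pmul2r (fact_gt0 (K - n))).
have binKi : ('C(K - i, n - i) * ((n - i)`! * (K - n)`!) = (K - i)`!)%N.
  by rewrite -(bin_fact (leq_sub2r i le_nK)) subnBA // subnK.
apply/eqP; transitivity ('C(K, n) * (n ^_ i * (n - i)`! * (K - n)`!))%N; first ring.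
rewrite ffact_fact // bin_fact // -(ffact_fact le_iK) -binKi; ring.
Qed.

(** The free upper bound [m] lets the range be enlarged until it contains a prescribed index; the
    added terms have a zero binomial coefficient. *)
Lemma exprDn_pad (R : comNzRingType) (a b : R) (x m : nat) : (x <= m)%N ->
  (a + b) ^+ x = \sum_(0 <= i < m.+1) a ^+ (x - i) * b ^+ i *+ 'C(x, i).
Proof.
move=> le_xm; rewrite exprDn -(big_mkord xpredT (fun i => a ^+ (x - i) * b ^+ i *+ 'C(x, i))).
by rewrite [RHS](@sum_nat_zero_tail _ _ x.+1) // => i lt_xi; rewrite bin_small.
Qed.

Lemma coef_1D_ZX_exp (R : comNzRingType) (c : R) (m j : nat) :
  ((1 + c *: 'X) ^+ m)`_j = c ^+ j *+ 'C(m, j).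
Proof.
rewrite (@exprDn_pad _ _ _ m (maxn m j)) ?leq_maxl // coef_sum.
rewrite (bigD1_seq j) ?iota_uniq //=; last first.
  by rewrite mem_index_iota /= ltnS leq_maxr.
rewrite big1 => [|i neq_ij]; rewrite expr1n mul1r exprZn coefMn coefZ coefXn.
  by rewrite eqxx mulr1 addr0.
by rewrite eq_sym (negbTE neq_ij) mulr0 mul0rn.
Qed.

(** Expand the [x]-th power of [(1 + 'X) - z 'X]: for [i <= x], its [i]-th term leaves the
    coefficient of ['X^(n - i)] in [(1 + 'X) ^+ (K - i)], which [mul_bin_ffact] matches with the
    hypergeometric term. *)
Lemma krawtchouk_generating (R : realType) (K n x : nat) (z : R) :
  (n <= K)%N -> (x <= K)%N ->
  'C(K, n)%:R * hyp2F1 (- n%:R) (- x%:R) (- K%:R) z =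
  ((1 + 'X) ^+ (K - x) * (1 + (1 - z) *: 'X) ^+ x)`_n.
Proof.
move=> le_nK le_xK; rewrite hyp2F1_krawtchouk mulr_sumr.
have -> : 1 + (1 - z) *: 'X = (1 + 'X) + (- z) *: 'X :> {poly R}.
  by rewrite scalerBl scale1r scaleNr addrA.
rewrite (@exprDn_pad _ _ _ x (maxn n x)) ?leq_maxr // mulr_sumr coef_sum.
have term_coef i : ((1 + 'X) ^+ (K - x) *
    ((1 + 'X) ^+ (x - i) * (- z *: 'X) ^+ i *+ 'C(x, i)))`_n =
  (if (n < i)%N then 0
   else (- z) ^+ i * ((1 + 'X) ^+ (K - x + (x - i)))`_(n - i)) *+ 'C(x, i).
  rewrite mulrnAr coefMn exprZn -scalerAr -scalerAr coefZ mulrA coefMXn exprD.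
  by case: ltnP; rewrite // mulr0.
(* Terms with [i > n] are divisible by ['X^i] and do not reach degree [n]. *)
rewrite [RHS](@sum_nat_zero_tail _ _ n.+1) ?ltnS ?leq_maxl //; last first.
  by move=> i lt_ni; rewrite term_coef lt_ni mul0rn.
apply: eq_big_nat => i /andP[_]; rewrite ltnS => le_in.
rewrite term_coef ltnNge le_in /=.
have [le_ix|lt_xi] := leqP i x; last first.
  by rewrite (bin_small lt_xi) mulr0n !(mulr0, mul0r).
rewrite addnBA // subnK //.
rewrite -[X in 1 + X]scale1r coef_1D_ZX_exp expr1n.
have K_neq0 : (K ^_ i)%:R != 0 :> R.
  by rewrite pnatr_eq0 -lt0n ffact_gt0 (leq_trans le_in).
have -> : 'C(K, n)%:R * ((n ^_ i)%:R / (K ^_ i)%:R * 'C(x, i)%:R * (- z) ^+ i)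
  = ('C(K, n) * n ^_ i)%:R / (K ^_ i)%:R * 'C(x, i)%:R * (- z) ^+ i :> R.
  by rewrite natrM; ring.
rewrite mul_bin_ffact ?le_in // natrM mulfK // -[RHS]mulr_natr; ring.
Qed.

(** * Binomial sums and coefficients in two variables *)

(** By [mul_bin_ffact], the falling factorial turns ['C(K, x)] into a multiple of
    ['C(K - k, x - k)]; shifting [x] by [k] leaves the binomial theorem. *)
Lemma sum_ffact_binomial (R : comNzRingType) (K k : nat) (a b : R) :
  (k <= K)%N ->
  \sum_(0 <= x < K.+1) (x ^_ k)%:R * ('C(K, x)%:R * a ^+ x * b ^+ (K - x)) =
  (K ^_ k)%:R * a ^+ k * (a + b) ^+ (K - k).
Proof.
move=> le_kK; rewrite (@big_cat_nat _ _ _ k) ?(leqW le_kK) //=.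
rewrite big_nat_cond big1 ?add0r; last first.
  by move=> x /andP[/andP[_ lt_xk] _]; rewrite ffact_small // mul0r.
rewrite -{1}[k]add0n big_addn subSn // addrC exprDn mulr_sumr big_mkord.
apply: eq_bigr => x _; have le_xKk : (x + k <= K)%N.
  by rewrite addnC -leq_subRL // -ltnS.
rewrite -mulr_natl.
have bE : 'C(K, x + k)%:R * ((x + k) ^_ k)%:R = 'C(K - k, x)%:R * (K ^_ k)%:R :> R.
  by rewrite -!natrM mul_bin_ffact ?leq_addl ?addnK.
rewrite exprD (addnC x k) subnDA -(addnC x k).
transitivity ('C(K, x + k)%:R * ((x + k) ^_ k)%:R *
  (a ^+ x * a ^+ k * b ^+ (K - k - x))); first ring.
rewrite bE; ring.
Qed.

(* The outer variable plays the role of [t], the inner one that of [s]. *)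
Lemma coef_diagonal (R : comNzRingType) (P Q : {poly R}) (d : R) (m n : nat) :
  ((P%:P * Q^:P * (1 + (d *: 'X)%:P * 'X) ^+ m)`_n)`_n =
  \sum_(0 <= i < n.+1) P`_i * Q`_i * (d ^+ (n - i) *+ 'C(m, n - i)).
Proof.
rewrite -mulrA coefCM coefM mulr_sumr coef_sum big_mkord.
apply: eq_bigr => i _.
rewrite coef_map /= !mul_polyC coef_1D_ZX_exp exprZn scalerMnl.
rewrite -scalerAr coefZ -scalerAr coefZ coefMXn ltnNge leq_subr /=.
by rewrite subKn -1?ltnS //; ring.
Qed.

(** Multiplied by [(n - i)! (K - k - (n - i))!], both sides become [K!]. If [n - i > K - k], then
    also [k - i > K - n], and both sides vanish. *)
Lemma ffact_mul_bin (K k n i : nat) :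
  (k <= K)%N -> (n <= K)%N -> (i <= n)%N -> (i <= k)%N ->
  (K ^_ k * 'C(K - k, n - i) = 'C(K, n) * (n ^_ i * (K - n) ^_ (k - i)))%N.
Proof.
move=> le_kK le_nK le_in le_ik.
have [le_niKk|lt_Kkni] := leqP (n - i) (K - k); last first.
  by rewrite bin_small // [(K - n) ^_ _]ffact_small ?muln0 //; lia.
have le_kiKn : (k - i <= K - n)%N by lia.
apply/eqP; rewrite -(eqn_pmul2r (fact_gt0 (n - i))).
rewrite -(eqn_pmul2r (fact_gt0 (K - k - (n - i)))); apply/eqP.
transitivity (K ^_ k *
  ('C(K - k, n - i) * ((n - i)`! * (K - k - (n - i))`!)))%N; first ring.
rewrite bin_fact // ffact_fact //.
have -> : (K - k - (n - i) = K - n - (k - i))%N by lia.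
transitivity ('C(K, n) * ((n ^_ i * (n - i)`!) *
  ((K - n) ^_ (k - i) * (K - n - (k - i))`!)))%N; last ring.
by rewrite !ffact_fact // bin_fact.
Qed.

(** The hypotheses state [c = 1 - 1/p] and [d = (1 - p)/p] without division. The constant terms add
    up to [1], the linear terms cancel since [p c + 1 - p = 0], and the mixed term has coefficient
    [p c^2 + 1 - p = d]. *)
Lemma krawtchouk_generating_factors (R : comNzRingType) (p c d : R) :
  p * c = p - 1 -> p * c * c = p - 1 + d ->
  p%:P%:P * ((1 + c *: 'X)%:P * (1 + c *: 'X)^:P)
    + (1 - p)%:P%:P * ((1 + 'X)%:P * (1 + 'X)^:P)
  = 1 + (d *: 'X)%:P * 'X :> {poly {poly R}}.
Proof.
move=> pc pcc; pose C (r : R) : {poly {poly R}} := r%:P%:P.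
have CD r s : C (r + s) = C r + C s by rewrite /C !polyCD.
have CN r : C (- r) = - C r by rewrite /C !polyCN.
have CM r s : C (r * s) = C r * C s by rewrite /C !polyCM.
have XE r : ((1 + r *: 'X)%:P = 1 + C r * 'X%:P :> {poly {poly R}})
    * ((1 + r *: 'X)^:P = 1 + C r * 'X :> {poly {poly R}}).
  by split; rewrite rmorphD rmorph1 /= -mul_polyC rmorphM /= ?map_polyX ?map_polyC.
have BE : (1 + 'X)^:P = 1 + 'X :> {poly {poly R}}.
  by rewrite rmorphD rmorph1 /= map_polyX.
rewrite !XE BE [(1 + 'X)%:P]polyCD polyC1 -mul_polyC polyCM -/(C p) -/(C d) -/(C (1 - p)).
transitivity (C p + C (p * c) * ('X%:P + 'X) + C (p * c * c) * ('X%:P * 'X)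
  + C (1 - p) * (1 + 'X%:P) * (1 + 'X)); first by rewrite !CM; ring.
rewrite pcc pc !CD !CN [C 1]rmorph1; ring.
Qed.

(** * Factorial moments of a single squared Krawtchouk polynomial *)

Lemma sum_ffact_krawtchouk_sqr (R : realType) (K k n : nat) (p : R) :
  p != 0 -> (k <= K)%N -> (n <= K)%N ->
  \sum_(0 <= x < K.+1) (x ^_ k)%:R *
    (('C(K, n)%:R * hyp2F1 (- n%:R) (- x%:R) (- K%:R) p^-1) ^+ 2
     * binomial_weight K p x) =
  (K ^_ k)%:R * p ^+ k *
  \sum_(0 <= i < n.+1) ((1 - p^-1) ^+ i *+ 'C(k, i)) ^+ 2
    * (((1 - p) / p) ^+ (n - i) *+ 'C(K - k, n - i)).
Proof.
move=> p_neq0 le_kK le_nK.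
set c := 1 - p^-1; set d := (1 - p) / p.
pose A : {poly R} := 1 + c *: 'X; pose B : {poly R} := 1 + 'X.
(* Absorbing the weights [p] and [1 - p] into the generating factors makes the sum over [x] a
   binomial sum in [a] and [b]. *)
pose a : {poly {poly R}} := p%:P%:P * (A%:P * A^:P).
pose b : {poly {poly R}} := (1 - p)%:P%:P * (B%:P * B^:P).
have abE : a + b = 1 + (d *: 'X)%:P * 'X.
  by apply: krawtchouk_generating_factors; rewrite /c /d; field.
have coefE x : (x <= K)%N ->
  (x ^_ k)%:R *
    (('C(K, n)%:R * hyp2F1 (- n%:R) (- x%:R) (- K%:R) p^-1) ^+ 2
     * binomial_weight K p x) =
  (((x ^_ k)%:R * ('C(K, x)%:R * a ^+ x * b ^+ (K - x)))`_n)`_n.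
  move=> le_xK; rewrite krawtchouk_generating // -/c -/A -/B.
  set P := B ^+ (K - x) * A ^+ x.
  have -> : (x ^_ k)%:R * ('C(K, x)%:R * a ^+ x * b ^+ (K - x)) =
      ((x ^_ k)%:R * binomial_weight K p x)%:P%:P * (P%:P * P^:P).
    rewrite /a /b /binomial_weight /P !rmorphM /= !rmorphXn /= !rmorph_nat !exprMn.
    ring.
  rewrite !coefCM coef_map /= coefMC; ring.
rewrite (eq_big_nat _ _ (F2 := fun x =>
  (((x ^_ k)%:R * ('C(K, x)%:R * a ^+ x * b ^+ (K - x)))`_n)`_n)); last first.
  by move=> x /andP[_]; rewrite ltnS => /coefE.
rewrite -!coef_sum sum_ffact_binomial // abE.
have -> : (K ^_ k)%:R * a ^+ k =
    ((K ^_ k)%:R * p ^+ k)%:P%:P * ((A ^+ k)%:P * (A ^+ k)^:P).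
  by rewrite /a !rmorphM /= !rmorphXn /= !rmorph_nat !exprMn; ring.
rewrite -[_ * _ * _ ^+ _]mulrA !coefCM coef_diagonal; congr (_ * _).
by apply: eq_bigr => i _; rewrite !coef_1D_ZX_exp expr2.
Qed.

Lemma krawtchouk_moment (R : realType) (K k n : nat) (p : R) :
  0 < p -> p < 1 -> (n <= K)%N ->
  \sum_(0 <= x < K.+1)
    (x ^_ k)%:R * (krawtchouk K p n x ^+ 2 * binomial_weight K p x) =
  \sum_(0 <= i < k.+1) p ^+ (k - i) * (1 - p) ^+ i * 'C(k, i)%:R ^+ 2
    * (n ^_ i * (K - n) ^_ (k - i))%:R.
Proof.
(* For [k > K] both sides vanish: on the left [x <= K < k], on the right [i > n] or
   [k - i > K - n]. *)
move=> p_gt0 p_lt1 le_nK; have [le_kK|lt_Kk] := leqP k K; last first.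
  rewrite big_nat_cond big1 => [|x /andP[/andP[_ lt_xK] _]]; last first.
    by rewrite ffact_small ?mul0r // (leq_ltn_trans _ lt_Kk).
  rewrite big_nat_cond big1 // => i /andP[/andP[_ lt_ik] _].
  have [lt_ni|le_in] := ltnP n i; first by rewrite ffact_small // mulr0.
  by rewrite [(K - n) ^_ _]ffact_small ?muln0 ?mulr0 //; lia.
have p_neq0 : p != 0 by rewrite gt_eqF.
have q_neq0 : 1 - p != 0 by rewrite subr_eq0 gt_eqF.
have bin_neq0 : 'C(K, n)%:R != 0 :> R by rewrite pnatr_eq0 -lt0n bin_gt0.
(* The squared normalisation is ['C(K, n) (p / (1 - p))^n]; the generating function supplies
   ['C(K, n)] squared, hence the quotient. *)
transitivity ((p / (1 - p)) ^+ n / 'C(K, n)%:R *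
  \sum_(0 <= x < K.+1) (x ^_ k)%:R *
    (('C(K, n)%:R * hyp2F1 (- n%:R) (- x%:R) (- K%:R) p^-1) ^+ 2
     * binomial_weight K p x)).
  rewrite mulr_sumr; apply: eq_bigr => x _.
  rewrite /krawtchouk exprMn sqr_sqrtr; last first.
    by rewrite mulr_ge0 ?ler0n // exprn_ge0 // divr_ge0 ?subr_ge0 ?ltW.
  by field.
rewrite sum_ffact_krawtchouk_sqr //.
(* One sum stops at [n] and the other at [k]; over a common range they agree term by term. *)
rewrite (@big_nat_widen _ _ _ 0 n.+1 (maxn n k).+1) ?ltnS ?leq_maxl //.
rewrite [RHS](@big_nat_widen _ _ _ 0 k.+1 (maxn n k).+1) ?ltnS ?leq_maxr //.
rewrite big_mkcond [RHS]big_mkcond !mulr_sumr; apply: eq_bigr => i _ /=.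
rewrite !ltnS; case: leqP => [le_in|lt_ni]; case: leqP => [le_ik|lt_ki]; last first.
- by rewrite !mulr0.
- by rewrite !mulr0 ffact_small // mulr0.
- by rewrite (bin_small lt_ki) !mulr0n expr0n /= mul0r !(mulr0, mul0r).
have natE : (K ^_ k)%:R * 'C(K - k, n - i)%:R
    = 'C(K, n)%:R * (n ^_ i * (K - n) ^_ (k - i))%:R :> R.
  by rewrite -!natrM ffact_mul_bin.
set d := (1 - p) / p; have d_neq0 : d != 0 by rewrite mulf_neq0 ?invr_neq0.
have -> : 1 - p^-1 = - d by rewrite /d; field.
have -> : p / (1 - p) = d^-1 by rewrite invf_div.
have dE : d ^+ n = d ^+ i * d ^+ (n - i) by rewrite -exprD subnKC.
have qE : (1 - p) ^+ i = p ^+ i * d ^+ i by rewrite -exprMn /d mulrCA divff ?mulr1.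
have pE : p ^+ k = p ^+ (k - i) * p ^+ i by rewrite -exprD subnK.
rewrite -[(- d) ^+ i *+ _]mulr_natr -[d ^+ (n - i) *+ _]mulr_natr exprVn.
have dsq : ((- d) ^+ i) ^+ 2 = d ^+ i * d ^+ i.
  by rewrite exprNn exprMn sqrr_sign mul1r expr2.
rewrite [((- d) ^+ i * _) ^+ 2]exprMn dsq qE pE dE.
(* The powers of [d] combine as [-n + 2i + (n - i) = i]. *)
transitivity (p ^+ (k - i) * (p ^+ i * d ^+ i) * 'C(k, i)%:R ^+ 2
  * ((K ^_ k)%:R * 'C(K - k, n - i)%:R / 'C(K, n)%:R)).
  by field; rewrite bin_neq0 !expf_neq0.
by rewrite natE mulrC [_ * _ / _]mulrAC divff // mul1r mulrC.
Qed.

(** * From single polynomials to the one-point function *)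

(** For [j > m] the convention for negative arguments agrees with the vanishing of the falling
    factorial. *)
Lemma fact_inv_fact (R : realType) (m j : nat) :
  m`!%:R * inv_fact (m%:Z - j%:Z) = (m ^_ j)%:R :> R.
Proof.
have [le_jm|lt_mj] := leqP j m.
  rewrite subzn //= -(ffact_fact le_jm) natrM mulfK //.
  by rewrite pnatr_eq0 -lt0n fact_gt0.
rewrite ffact_small //; have -> : m%:Z - j%:Z = Negz (j - m).-1.
  by rewrite NegzE prednK ?subn_gt0 // -subzn ?(ltnW lt_mj) // opprB.
by rewrite mulr0.
Qed.

Theorem theorem3 (R : realType) (N K k : nat) (p : R)
    (N_ge1 : (1 <= N)%N) (K_geN : (N <= K)%N) (p_gt0 : 0 < p) (p_lt1 : p < 1) :
  factorial_moment K p k N =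
  \sum_(0 <= i < k.+1)
    p ^+ (k - i) * (1 - p) ^+ i * 'C(k, i)%:R ^+ 2
    * (N%:R^-1 *
       \sum_(i <= l < N)
         l`!%:R * (K - l)`!%:R
         * inv_fact (l%:Z - i%:Z) * inv_fact (K%:Z - l%:Z - k%:Z + i%:Z)).
Proof.
transitivity (N%:R^-1 * \sum_(0 <= l < N) \sum_(0 <= x < K.+1)
    (x ^_ k)%:R * (krawtchouk K p l x ^+ 2 * binomial_weight K p x)).
  rewrite exchange_big mulr_sumr; apply: eq_bigr => x _.
  by rewrite /one_point mulrCA mulr_sumr.
transitivity (N%:R^-1 * \sum_(0 <= l < N) \sum_(0 <= i < k.+1)
    p ^+ (k - i) * (1 - p) ^+ i * 'C(k, i)%:R ^+ 2
    * (l ^_ i * (K - l) ^_ (k - i))%:R).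
  congr (_ * _); apply: eq_big_nat => l /andP[_ lt_lN].
  by rewrite krawtchouk_moment // ltnW // (leq_trans lt_lN).
rewrite exchange_big mulr_sumr; apply: eq_big_nat => i /andP[_]; rewrite ltnS => le_ik.
rewrite -mulr_sumr mulrCA; congr (_ * (_ * _)).
(* The inner sum may start at [0] instead of [i], because [l ^_ i] is zero for [l < i]. *)
rewrite (@big_nat_widenl _ _ _ i 0) // big_mkcondr.
apply: eq_big_nat => l /andP[_ lt_lN]; case: leqP => [le_il|lt_li]; last first.
  by rewrite ffact_small.
(* The truncated differences are genuine since [l < N <= K] and [i <= k]; this is the form to which
   [fact_inv_fact] applies. *)
have -> : K%:Z - l%:Z - k%:Z + i%:Z = (K - l)%:Z - (k - i)%:Z.
  by rewrite -!subzn //; [ring | rewrite ltnW // (leq_trans lt_lN)].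
rewrite natrM -!fact_inv_fact; ring.
Qed.
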